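(* Let $P$ be a Markov chain kernel on a measurable space $(\mathcal{X},\mathcal{F})$ with unique stationary distribution $\pi(\cdot)$. If $P$ is reversible with respect to $\pi(\cdot)$ and geometrically ergodic, then $P$ is variance bounding.
   Context: Let $\{X_n\}_{n\ge 0}$ be the Markov chain with kernel $P$ started in stationarity ($X_0\sim\pi$). For measurable $h:\mathcal{X}\to\mathbf{R}$, $\operatorname{Var}_\pi(h)=\mathbf{E}[(h(X_0)-\mathbf{E}[h(X_0)])^2]$ is the stationary variance, and $\operatorname{Var}(h,P)=\lim_{n\to\infty}\frac1n\operatorname{Var}\left(\sum_{i=1}^n h(X_i)\right)$ is the asymptotic variance (for reversible $P$ and $h\in L^2(\pi)$ the limit always exists in $[0,\infty]$). $P$ is variance bounding if there is $K<\infty$ such that $\operatorname{Var}(h,P)\le K\operatorname{Var}_\pi(h)$ for all measurable $h:\mathcal{X}\to\mathbf{R}$ (the inequality is regarded as holding automatically when $\operatorname{Var}_\pi(h)=\infty$). $P$ is reversible with respect to $\pi$ if $\int_{A}\pi(dx)P(x,B)=\int_{B}\pi(dx)P(x,A)$ for all $A,B\in\mathcal{F}$. $P$ is geometrically ergodic if there are $\rho<1$ and $M:\mathcal{X}\to[0,\infty]$ with $\pi\{x: M(x)<\infty\}=1$ such that $|P^n(x,A)-\pi(A)|\le M(x)\rho^n$ for all $A\in\mathcal{F}$, $n\in\mathbf{N}$, $x\in\mathcal{X}$. *)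

(* Defs.v *)
From HB Require Import structures.
From mathcomp Require Import all_boot all_order all_algebra.
From mathcomp Require Import all_classical all_reals all_analysis.
Set Implicit Arguments.
Unset Strict Implicit.
Unset Printing Implicit Defensive.
Import Order.TTheory GRing.Theory Num.Theory.
Import numFieldNormedType.Exports.
Local Open Scope classical_set_scope.
Local Open Scope ring_scope.

Section kernel_properties.
Context (d : measure_display) (T : measurableType d) (R : realType).
Local Open Scope ereal_scope.

Fixpoint kernel_pow (P : R.-pker T ~> T) (n : nat) (x : T) (A : set T) : \bar R :=
  match n with
  | 0%N => \d_x A
  | m.+1 => \int[P x]_y kernel_pow P m y A
  end.

Definition stationary (P : R.-pker T ~> T) (pi : probability T R) : Prop :=
  forall A, measurable A -> \int[pi]_x P x A = pi A.

Definition unique_stationary (P : R.-pker T ~> T) (pi : probability T R) : Prop :=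
  stationary P pi /\
  forall mu : probability T R, stationary P mu ->
    forall A, measurable A -> mu A = pi A.

Definition reversible (P : R.-pker T ~> T) (pi : probability T R) : Prop :=
  forall A B, measurable A -> measurable B ->
    \int[pi]_(x in A) P x B = \int[pi]_(x in B) P x A.

(* [M] itself need not be measurable, only the event [M < +oo] is an event. *)
Definition geometrically_ergodic (P : R.-pker T ~> T) (pi : probability T R) : Prop :=
  exists (rho : R) (M : T -> \bar R),
    [/\ (rho < 1)%R,
        (forall x, 0 <= M x),
        measurable [set x | M x < +oo],
        pi [set x | M x < +oo] = 1 &
        forall (n : nat) (x : T) (A : set T), (0 < n)%N -> measurable A ->
          `|kernel_pow P n x A - pi A| <= M x * (rho ^+ n)%:E].

End kernel_properties.

Section chain.
Context (d : measure_display) (T : measurableType d) (R : realType).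
Local Open Scope ereal_scope.

(* The Markov property P(X_{n+1} in B | X_0, ..., X_n) = P(X_n, B), integrated
   over the events {X_0 in A_0, ..., X_n in A_n}, which form a pi-system
   generating the sigma-algebra of (X_0, ..., X_n). *)
Definition stationary_markov_chain (P : R.-pker T ~> T) (pi : probability T R)
    (d' : measure_display) (Omega : measurableType d') (Pr : probability Omega R)
    (X : nat -> {RV Pr >-> T}) : Prop :=
  (forall A, measurable A -> distribution Pr (X 0%N) A = pi A) /\
  forall (n : nat) (A : nat -> set T) (B : set T),
    (forall i, measurable (A i)) -> measurable B ->
    let past := \bigcap_(i in `I_n.+1) X i @^-1` A i in
    Pr (past `&` X n.+1 @^-1` B) = \int[Pr]_(w in past) P (X n w) B.

Definition scaled_variance (d' : measure_display) (Omega : measurableType d')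
    (Pr : probability Omega R) (X : nat -> {RV Pr >-> T}) (h : T -> R)
    (n : nat) : \bar R :=
  (n%:R^-1)%:E * 'V_Pr[fun w => (\sum_(1 <= i < n.+1) h (X i w))%R].

Definition asymptotic_variance (d' : measure_display) (Omega : measurableType d')
    (Pr : probability Omega R) (X : nat -> {RV Pr >-> T}) (h : T -> R) : \bar R :=
  limn (scaled_variance X h).

(* [limn] returns a default value on divergent sequences, hence the explicit
   convergence clause. Convergence is in [\bar R], so the limit +oo is not
   excluded by it. The asymptotic variance depends only on the law of the chain,
   which P and pi determine; K is uniform over its realizations X.
   If h is not in L^2(pi), then ['V_pi[h]] = +oo and nothing is required. *)
Definition variance_bounding (P : R.-pker T ~> T) (pi : probability T R) : Prop :=
  exists K : R, forall h : {mfun T >-> R}, 'V_pi[h] < +oo ->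
    forall (d' : measure_display) (Omega : measurableType d')
      (Pr : probability Omega R) (X : nat -> {RV Pr >-> T}),
    stationary_markov_chain P pi X ->
    cvgn (scaled_variance X h) /\
    asymptotic_variance X h <= K%:E * 'V_pi[h].

End chain.

(* Main.v *)
(** Let K be the operator f |-> Pf on bounded functions; reversibility makes it
    self-adjoint in L2(pi). Geometric ergodicity bounds
    <f, K^n f> - (pi f)^2 by C rho^n, with C depending on f, for every simple f
    supported in a set where M is bounded. By self-adjointness and
    Cauchy-Schwarz such a bound improves to rho^n <f, f>, without any constant
    depending on f. These functions f approximate every h in L2(pi), pointwise and
    dominated by |h|, so the centered autocovariances of h along the stationary
    chain are at most rho^k Var_pi(h). Expanding the variance of the partial
    sums and averaging (Cesaro) then gives the convergence of the scaled
    variances and the constant K = 1 + 2 rho / (1 - rho). *)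
Require Import Defs.
From mathcomp Require Import all_boot all_order all_algebra.
From mathcomp Require Import all_classical all_reals all_analysis.
From mathcomp Require Import finmap measurable_realfun ring lra zify.
Set Implicit Arguments.
Unset Strict Implicit.
Unset Printing Implicit Defensive.
Import Order.TTheory GRing.Theory Num.Theory.
Import numFieldNormedType.Exports.
Local Open Scope classical_set_scope.
Local Open Scope ring_scope.

(** * Bounded measurable functions and their integrals *)

Section bounded_functions.
Context d (T : measurableType d) (R : realType).
Implicit Types (f g : T -> R) (A : set T).

Definition bounded_measurable f :=
  measurable_fun setT f /\ exists c, forall x, `|f x| <= c.

Lemma bm_cst c : bounded_measurable (fun=> c).
Proof. by split; [exact: measurable_cst | exists `|c|]. Qed.

Lemma bm_indic A : measurable A -> bounded_measurable \1_A.
Proof.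
move=> mA; split; first exact: measurable_indic.
by exists 1 => x; rewrite indicE; case: (x \in A); rewrite ?normr1 ?normr0.
Qed.

Lemma bm_mul f g : bounded_measurable f -> bounded_measurable g ->
  bounded_measurable (fun x => f x * g x).
Proof.
move=> [mf [c fc]] [mg [e ge]]; split; first exact: measurable_funM.
by exists (c * e) => x; rewrite normrM ler_pM.
Qed.

Lemma bm_lin a f g : bounded_measurable f -> bounded_measurable g ->
  bounded_measurable (fun x => a * f x + g x).
Proof.
move=> [mf [c fc]] [mg [e ge]]; split.
  by apply: measurable_funD => //; apply: measurable_funM.
exists (`|a| * c + e) => x; rewrite (le_trans (ler_normD _ _))//.
by rewrite lerD// normrM ler_wpM2l.
Qed.

Section induction.
Import HBNNSimple.
Variable C : (T -> R) -> Prop.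
Hypothesis Cindic : forall A, measurable A -> C \1_A.
Hypothesis Clin : forall a f g, C f -> C g -> C (fun x => a * f x + g x).

Lemma simple_ind (s : {nnsfun T >-> R}) : C s.
Proof.
have -> : (s : T -> R) = fun x =>
    \sum_(y <- fset_set (range s)) (y * \1_(s @^-1` [set y]) x).
  by apply/funext => x; rewrite fimfunE fsbig_finite.
elim: (enum_fset _) => [|y r IH]; last first.
  under [X in C X]eq_fun do rewrite big_cons.
  by apply: Clin => //; exact: Cindic.
under [X in C X]eq_fun do rewrite big_nil.
(* The empty sum is obtained as [-1] times an indicator plus the same indicator. *)
have := Clin (-1) (Cindic measurable0) (Cindic measurable0).
by congr C; apply/funext => x; rewrite mulN1r addNr.
Qed.

(** Positive and negative parts are approximated from below separately, which keeps [|s n| <= |f|].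
    This domination is what permits limits under the integral when [f] is unbounded. *)
Lemma simple_approx f : measurable_fun setT f ->
  exists s : nat -> T -> R,
    [/\ forall n, C (s n), forall n, measurable_fun setT (s n),
        forall n x, `|s n x| <= `|f x| & forall x, s ^~ x @ \oo --> f x].
Proof.
move=> mf.
have mp : measurable_fun setT (EFin \o f^\+).
  by apply/measurable_EFinP; exact: measurable_funrpos.
have mn : measurable_fun setT (EFin \o f^\-).
  by apply/measurable_EFinP; exact: measurable_funrneg.
pose sp := nnsfun_approx measurableT mp.
pose sn := nnsfun_approx measurableT mn.
have p0 x : setT x -> (0 <= (EFin \o f^\+%R) x)%E by move=> _; rewrite lee_fin.
have n0 x : setT x -> (0 <= (EFin \o f^\-%R) x)%E by move=> _; rewrite lee_fin.
have leP n x : sp n x <= f^\+ x.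
  by rewrite -lee_fin /sp nnsfun_approxE; exact: le_approx.
have leN n x : sn n x <= f^\- x.
  by rewrite -lee_fin /sn nnsfun_approxE; exact: le_approx.
exists (fun n x => (-1) * sn n x + sp n x); split.
- by move=> n; apply: Clin; exact: simple_ind.
- by move=> n; apply: measurable_funD => //; apply: measurable_funM.
- move=> n x; rewrite mulN1r (le_trans (ler_normD _ _))// normrN.
  rewrite (ger0_norm (fun_ge0 x : 0 <= sn n x)).
  rewrite (ger0_norm (fun_ge0 x : 0 <= sp n x)).
  have <- : f^\+ x + f^\- x = `|f x|.
    exact: (congr1 (fun h : T -> R => h x) (funrposDneg f)).
  by rewrite addrC lerD.
- move=> x; rewrite [f x](_ : _ = (-1) * f^\- x + f^\+ x); last first.
    by rewrite mulN1r addrC; apply/esym;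
      exact: (congr1 (fun h : T -> R => h x) (funrposBneg f)).
  apply: cvgD.
    apply: cvgMl_tmp.
    by have /fine_cvg := cvg_nnsfun_approx measurableT mn n0 (I : setT x); exact.
  by have /fine_cvg := cvg_nnsfun_approx measurableT mp p0 (I : setT x); exact.
Qed.

Hypothesis Clim : forall (f_ : nat -> T -> R) f (c : R),
  (forall n, measurable_fun setT (f_ n)) -> (forall n, C (f_ n)) ->
  (forall n x, `|f_ n x| <= c) -> (forall x, f_ ^~ x @ \oo --> f x) -> C f.

(** Domination by [|f|] gives the simple approximants the uniform bound that [Clim] asks for. In
    each application [C] carries boundedness as an extra conjunct, because the linearity lemmas need
    it. *)
Lemma bounded_measurable_ind f : bounded_measurable f -> C f.
Proof.
move=> [mf [c fc]]; have [s [Cs ms sf s_f]] := simple_approx mf.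
by apply: (Clim ms Cs _ s_f) => n x; rewrite (le_trans (sf n x)).
Qed.

End induction.

Lemma bounded_pointwise_lim (f_ : nat -> T -> R) f (c : R) :
  (forall n, measurable_fun setT (f_ n)) ->
  (forall n x, `|f_ n x| <= c) -> (forall x, f_ ^~ x @ \oo --> f x) ->
  measurable_fun setT f /\ forall x, `|f x| <= c.
Proof.
move=> mf_ f_c f_f; split.
  by apply: (measurable_fun_cvg mf_) => x _; exact: f_f.
move=> x; have fx : (fun n => `|f_ n x|) @ \oo --> `|f x|.
  by apply: cvg_norm; exact: f_f.
rewrite -(cvg_lim _ fx)//; apply: limr_le; first by apply/cvg_ex; exists `|f x|.
by apply: nearW => n; exact: f_c.
Qed.

End bounded_functions.

Section real_integral.
Context d (T : measurableType d) (R : realType).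
Variable mu : {measure set T -> \bar R}.
Implicit Types f g : T -> R.

Lemma Rintegral_dominated_cvg (f_ : nat -> T -> R) f g :
  (forall n, measurable_fun setT (f_ n)) ->
  (forall x, f_ ^~ x @ \oo --> f x) ->
  mu.-integrable setT (EFin \o g) -> (forall n x, `|f_ n x| <= g x) ->
  (fun n => \int[mu]_x f_ n x) @ \oo --> \int[mu]_x f x.
Proof.
move=> mf_ f_f ig f_g.
have mEf_ n : measurable_fun setT (EFin \o f_ n) by exact/measurable_EFinP.
have mf : measurable_fun setT (EFin \o f).
  by apply/measurable_EFinP; apply: (measurable_fun_cvg mf_) => x _; exact: f_f.
have f_f' : {ae mu, forall x, setT x -> (EFin \o f_ ^~ x) @ \oo --> (f x)%:E}.
  by apply: aeW => x _; apply: cvg_EFin; [exact: nearW | exact: f_f].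
have f_g' : {ae mu, forall x n, setT x ->
    (`|(EFin \o f_ n) x| <= (EFin \o g) x)%E}.
  by apply: aeW => x n _; rewrite lee_fin.
have [fi _] := dominated_convergence measurableT mEf_ mf f_f' ig f_g'.
rewrite -[X in _ --> X -> _]fineK; last exact: integrable_fin_num.
by move=> /fine_cvg.
Qed.

(** Unit mass is assumed of a measure, instead of taking a probability, so that [pi], [Pr] and each
    [P x] are covered alike. *)
Hypothesis mu1 : mu setT = 1%E.

Lemma bm_integrable f : bounded_measurable f ->
  mu.-integrable setT (EFin \o f).
Proof.
move=> [mf [c fc]]; apply: measurable_bounded_integrable => //.
  by rewrite [X in (X < _)%E]mu1 ltry.
by exists c; split; [exact: num_real | move=> t ct x _; exact: le_trans (ltW ct)].
Qed.

Lemma Rintegral_lin a f g : mu.-integrable setT (EFin \o f) ->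
  mu.-integrable setT (EFin \o g) ->
  \int[mu]_x (a * f x + g x) = a * (\int[mu]_x f x) + \int[mu]_x g x.
Proof.
move=> fi gi; rewrite RintegralD//; first by rewrite RintegralZl.
by apply: (eq_integrable measurableT) (integrableZl measurableT a fi).
Qed.

Lemma Rintegral_prob_cst c : \int[mu]_x (fun=> c) x = c.
Proof. by rewrite Rintegral_cst// [X in fine X]mu1 mulr1. Qed.

Lemma normr_Rintegral_le f c : measurable_fun setT f ->
  (forall x, `|f x| <= c) -> `|\int[mu]_x f x| <= c.
Proof.
move=> mf fc; have bf : bounded_measurable f by split => //; exists c.
rewrite (le_trans (le_normr_Rintegral _ (bm_integrable bf)))//.
rewrite -[leRHS]Rintegral_prob_cst le_Rintegral//; apply: bm_integrable.
  by split; [exact: measurableT_comp | exists c => x; rewrite normr_id].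
exact: bm_cst.
Qed.

Lemma Rintegral_indic A : measurable A -> \int[mu]_x \1_A x = fine (mu A).
Proof. by move=> mA; rewrite /Rintegral integral_indic// setIT. Qed.

Lemma Rintegral_bounded_cvg (f_ : nat -> T -> R) f (c : R) :
  (forall n, measurable_fun setT (f_ n)) ->
  (forall n x, `|f_ n x| <= c) -> (forall x, f_ ^~ x @ \oo --> f x) ->
  (fun n => \int[mu]_x f_ n x) @ \oo --> \int[mu]_x f x.
Proof.
move=> mf_ f_c f_f; apply: (Rintegral_dominated_cvg mf_ f_f _ f_c).
exact/bm_integrable/bm_cst.
Qed.

End real_integral.

(** * The transition operator *)

Section kernel_operator.
Context d (T : measurableType d) (R : realType).
Variable P : R.-pker T ~> T.
Implicit Types f g : T -> R.

Definition kop f (x : T) : R := \int[P x]_y f y.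

Lemma kop_indic A : measurable A -> kop \1_A = fun x => fine (P x A).
Proof. by move=> mA; apply/funext => x; rewrite /kop Rintegral_indic. Qed.

Lemma kop_lin a f g : bounded_measurable f -> bounded_measurable g ->
  kop (fun x => a * f x + g x) = fun x => a * kop f x + kop g x.
Proof.
move=> bf bg; apply/funext => x; rewrite /kop.
by rewrite Rintegral_lin//; apply: bm_integrable => //; exact: prob_kernel.
Qed.

Lemma kop_norm_le f c : measurable_fun setT f -> (forall x, `|f x| <= c) ->
  forall x, `|kop f x| <= c.
Proof.
by move=> mf fc x; apply: normr_Rintegral_le => //; exact: prob_kernel.
Qed.

Lemma kop_cvg (f_ : nat -> T -> R) f (c : R) :
  (forall n, measurable_fun setT (f_ n)) ->
  (forall n x, `|f_ n x| <= c) -> (forall x, f_ ^~ x @ \oo --> f x) ->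
  forall x, (fun n => kop (f_ n) x) @ \oo --> kop f x.
Proof.
move=> mf_ f_c f_f x.
by apply: (Rintegral_bounded_cvg _ mf_ f_c f_f); exact: prob_kernel.
Qed.

(** The bound is inherited by averaging. Measurability holds for indicators by measurability of the
    kernel and survives bounded limits by dominated convergence. *)
Lemma kop_bm f : bounded_measurable f -> bounded_measurable (kop f).
Proof.
move=> bf; have [mf [c fc]] := bf; split; last first.
  by exists c; exact: kop_norm_le.
suff [] : bounded_measurable f /\ measurable_fun setT (kop f) by [].
elim/bounded_measurable_ind: bf => {mf c fc f}.
- move=> A mA; split; first exact: bm_indic.
  rewrite kop_indic//; apply: measurableT_comp => //.
  exact: measurable_kernel.
- move=> a f g [bf mf] [bg mg]; split; first exact: bm_lin.
  by rewrite kop_lin//; apply: measurable_funD => //; apply: measurable_funM.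
- move=> f_ f c mf_ Cf_ f_c f_f; split.
    by have [mf fc] := bounded_pointwise_lim mf_ f_c f_f; split => //; exists c.
  apply: (measurable_fun_cvg (fun n => (Cf_ n).2)) => x _.
  exact: (kop_cvg mf_ f_c f_f).
Qed.

Lemma iter_kop_bm n f : bounded_measurable f -> bounded_measurable (iter n kop f).
Proof. by move=> bf; elim: n => //= n; exact: kop_bm. Qed.

Lemma iter_kop_lin n a f g : bounded_measurable f -> bounded_measurable g ->
  iter n kop (fun x => a * f x + g x) =
  fun x => a * iter n kop f x + iter n kop g x.
Proof.
by move=> bf bg; elim: n => //= n ->; rewrite kop_lin//; exact: iter_kop_bm.
Qed.

Lemma iter_kop_cst n c : iter n kop (fun=> c) = fun=> c.
Proof.
elim: n => //= n ->; apply/funext => x.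
by rewrite /kop Rintegral_prob_cst//; exact: prob_kernel.
Qed.

(** Links the extended-real kernel powers in [geometrically_ergodic] to the iterates of the
    operator; both peel off the first step of the chain. *)
Lemma kernel_powE n x A : measurable A ->
  kernel_pow P n x A = (iter n kop \1_A x)%:E.
Proof.
move=> mA; elim: n x => [x|n IH x] /=; first by rewrite diracE indicE.
under eq_integral do rewrite IH.
rewrite /kop /Rintegral fineK//; apply: integrable_fin_num => //.
by apply: bm_integrable; [exact: prob_kernel | exact/iter_kop_bm/bm_indic].
Qed.

End kernel_operator.

(** * The L2 pairing, Cauchy-Schwarz and the variance *)

Section bilinear.
Context d (T : measurableType d) (R : realType).
Variable pi : probability T R.
Implicit Types f g h : T -> R.

Definition inner f g : R := \int[pi]_x (f x * g x).

Let bmi f : bounded_measurable f -> pi.-integrable setT (EFin \o f).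
Proof. by move=> bf; apply: bm_integrable => //; exact: probability_setT. Qed.

Lemma innerC f g : inner f g = inner g f.
Proof. by apply: eq_Rintegral => x _; rewrite mulrC. Qed.

Definition square_integrable f :=
  measurable_fun setT f /\ pi.-integrable setT (EFin \o (fun x => f x ^+ 2)).

Lemma bm_square_integrable f : bounded_measurable f -> square_integrable f.
Proof.
by move=> bf; split; [case: bf | apply: (bmi (bm_mul bf bf))].
Qed.

(** Expanding the squares of [f + g] and [f - g] gives [|f g| <= f ^ 2 + g ^ 2]. *)
Lemma square_integrableM f g : square_integrable f -> square_integrable g ->
  pi.-integrable setT (EFin \o (fun x => f x * g x)).
Proof.
move=> [mf fi] [mg gi].
apply: le_integrable (integrableD measurableT fi gi) => //.
  by apply/measurable_EFinP; exact: measurable_funM.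
move=> x _; rewrite lee_fin.
rewrite [leRHS]ger0_norm ?addr_ge0 ?sqr_ge0// ler_norml.
have := sqr_ge0 (f x + g x); have := sqr_ge0 (f x - g x).
by have := sqr_ge0 (f x); have := sqr_ge0 (g x); rewrite !expr2; nra.
Qed.

Lemma square_integrable_integrable f : square_integrable f ->
  pi.-integrable setT (EFin \o f).
Proof.
move=> sf; have := square_integrableM sf (bm_square_integrable (bm_cst T 1)).
by apply: eq_integrable => // x _ /=; rewrite mulr1.
Qed.

Lemma square_integrable_lin a f g : square_integrable f -> square_integrable g ->
  square_integrable (fun x => a * f x + g x).
Proof.
move=> sf sg; have [mf fi] := sf; have [mg gi] := sg; split.
  by apply: measurable_funD => //; exact: measurable_funM.
have fgi := square_integrableM sf sg.
have := integrableD measurableT (integrableZl measurableT (a ^+ 2) fi)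
  (integrableD measurableT (integrableZl measurableT (2 * a) fgi) gi).
apply: eq_integrable => // x _ /=; rewrite -!EFinM -!EFinD; congr (_%:E).
ring.
Qed.

Lemma L2_inner_linr a h f g : square_integrable h -> square_integrable f ->
  square_integrable g ->
  inner h (fun x => a * f x + g x) = a * inner h f + inner h g.
Proof.
move=> bh bf bg; rewrite /inner -Rintegral_lin; [|exact: square_integrableM..].
by apply: eq_Rintegral => x _; ring.
Qed.

Lemma L2_inner_linl a h f g : square_integrable h -> square_integrable f ->
  square_integrable g ->
  inner (fun x => a * f x + g x) h = a * inner f h + inner g h.
Proof. by move=> *; rewrite innerC L2_inner_linr// !(innerC h). Qed.

Lemma inner_linr a h f g : bounded_measurable h -> bounded_measurable f ->
  bounded_measurable g ->
  inner h (fun x => a * f x + g x) = a * inner h f + inner h g.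
Proof. by move=> *; apply: L2_inner_linr; exact: bm_square_integrable. Qed.

Lemma inner_linl a h f g : bounded_measurable h -> bounded_measurable f ->
  bounded_measurable g ->
  inner (fun x => a * f x + g x) h = a * inner f h + inner g h.
Proof. by move=> *; rewrite innerC inner_linr// !(innerC h). Qed.

Lemma inner_indicl (A : set T) f : inner \1_A f = \int[pi]_(x in A) f x.
Proof.
rewrite Rintegral_mkcond; apply: eq_Rintegral => x _.
by rewrite patchE indicE; case: (x \in A); rewrite ?mul1r ?mul0r.
Qed.

Lemma inner_cst1 f : inner (fun=> 1) f = \int[pi]_x f x.
Proof. by apply: eq_Rintegral => x _; rewrite mul1r. Qed.

Lemma inner_ge0 f : 0 <= inner f f.
Proof. by apply: Rintegral_ge0 => x _; rewrite -expr2 sqr_ge0. Qed.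

Lemma inner_bounded_cvgr (f_ : nat -> T -> R) f g c : bounded_measurable g ->
  (forall n, measurable_fun setT (f_ n)) ->
  (forall n x, `|f_ n x| <= c) -> (forall x, f_ ^~ x @ \oo --> f x) ->
  (fun n => inner g (f_ n)) @ \oo --> inner g f.
Proof.
move=> [mg [e ge]] mf_ f_c f_f.
apply: (@Rintegral_bounded_cvg _ _ _ _ _ _ _ (e * c)) => //.
- exact: probability_setT.
- by move=> n; exact: measurable_funM.
- by move=> n x; rewrite normrM ler_pM.
- by move=> x; apply: cvgMl_tmp; exact: f_f.
Qed.

Lemma discriminant_le (a b c : R) :
  (forall t, 0 <= a + 2 * t * b + t ^+ 2 * c) -> 0 <= c -> b ^+ 2 <= a * c.
Proof.
move=> H c0; have [z|cN0] := eqVneq c 0.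
  rewrite {}z mulr0 in H *; have [->|bN0] := eqVneq b 0; first by rewrite expr0n.
  (* With [c = 0] the polynomial is affine in [t]; this [t] makes it equal to -1. *)
  have := H (- (a + 1) / (2 * b)).
  rewrite (_ : _ + _ = -1); last by field.
  lra.
(* The minimizer of the quadratic. *)
have := H (- b / c); rewrite (_ : _ + _ = (a * c - b ^+ 2) / c); last by field.
by rewrite pmulr_lge0 ?invr_gt0 ?lt_def ?cN0// subr_ge0.
Qed.

Lemma inner_CS f g : bounded_measurable f -> bounded_measurable g ->
  inner f g ^+ 2 <= inner f f * inner g g.
Proof.
move=> bf bg; apply: discriminant_le; last exact: inner_ge0.
move=> t; have := inner_ge0 (fun x => t * g x + f x).
have bl : bounded_measurable (fun x => t * g x + f x) by exact: bm_lin.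
rewrite inner_linr// !inner_linl// (innerC g f).
by congr (_ <= _); ring.
Qed.

Lemma L2_varianceE f : square_integrable f ->
  let c := \int[pi]_x f x in
  'V_pi[f] = (inner (fun x => f x - c) (fun x => f x - c))%:E.
Proof.
move=> sf c; rewrite /variance !unlock.
have -> : fine (\int[pi]_w (f w)%:E) = c by [].
have sfc : square_integrable (fun x => f x - c).
  have := square_integrable_lin (- c) (bm_square_integrable (bm_cst T 1)) sf.
  by congr square_integrable; apply/funext => x; ring.
rewrite /inner /Rintegral fineK//.
exact: integrable_fin_num (square_integrableM sfc sfc).
Qed.

Lemma finite_variance_square_integrable f : measurable_fun setT f ->
  ('V_pi[f] < +oo)%E -> square_integrable f.
Proof.
(* Integrability of [f] is not yet known, so [c] might be the default value of [fine]. The argument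
   uses only that [c] is some real number with [f - c] in L2. *)
move=> mf; rewrite /variance !unlock; set c := fine _ => V.
have scf : square_integrable (fun x => f x - c).
  split; first exact: measurable_funB.
  apply/integrableP; split.
    by apply/measurable_EFinP/measurable_funX; exact: measurable_funB.
  apply: le_lt_trans V; rewrite le_eqVlt; apply/orP; left; apply/eqP.
  by apply: eq_integral => x _ /=; rewrite ger0_norm ?sqr_ge0// expr2.
have := square_integrable_lin c (bm_square_integrable (bm_cst T 1)) scf.
by congr square_integrable; apply/funext => x; ring.
Qed.

End bilinear.

(** * Reversible kernels *)

Section reversible_kernel.
Context d (T : measurableType d) (R : realType).
Variables (P : R.-pker T ~> T) (pi : probability T R).
Hypothesis P_rev : reversible P pi.
Implicit Types f g : T -> R.

(** On two indicators this is reversibility. It is extended to bounded functions one argument at a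
    time, first in [f] against an indicator, then in [g]. *)
Lemma inner_kop f g : bounded_measurable f -> bounded_measurable g ->
  inner pi f (kop P g) = inner pi (kop P f) g.
Proof.
move=> bf; move: f bf g.
have kopI A B : measurable A -> measurable B ->
    inner pi \1_A (kop P \1_B) = inner pi (kop P \1_A) \1_B.
  move=> mA mB; rewrite (innerC _ _ \1_B) !inner_indicl !kop_indic// /Rintegral.
  congr fine; transitivity (\int[pi]_(x in A) P x B)%E; last rewrite P_rev//.
    by apply: eq_integral => x _; rewrite fineK//; exact: finite_kernel_measure.
  by apply: eq_integral => x _; rewrite fineK//; exact: finite_kernel_measure.
have kopl f B : bounded_measurable f -> measurable B ->
    inner pi f (kop P \1_B) = inner pi (kop P f) \1_B.
  move=> bf mB; have bB := bm_indic R mB; have bKB := kop_bm P bB.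
  suff [] : bounded_measurable f /\
    inner pi f (kop P \1_B) = inner pi (kop P f) \1_B by [].
  elim/bounded_measurable_ind: bf => {f}.
  - by move=> A mA; split; [exact: bm_indic | exact: kopI].
  - move=> a f g [bf Hf] [bg Hg]; split; first exact: bm_lin.
    by rewrite kop_lin// !inner_linl ?Hf ?Hg//; exact: kop_bm.
  - move=> f_ f c mf_ Cf_ f_c f_f.
    have [mf fc] := bounded_pointwise_lim mf_ f_c f_f.
    split; first by split => //; exists c.
    rewrite (innerC _ f) (innerC _ (kop P f)).
    have L : (fun n => inner pi (kop P \1_B) (f_ n)) @ \oo -->
        inner pi (kop P \1_B) f by exact: inner_bounded_cvgr mf_ f_c f_f.
    have L' : (fun n => inner pi \1_B (kop P (f_ n))) @ \oo -->
        inner pi \1_B (kop P f).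
      apply: (@inner_bounded_cvgr _ _ _ _ _ _ _ c) => //.
      + by move=> n; apply: (kop_bm P (Cf_ n).1).1.
      + by move=> n; exact: kop_norm_le.
      + exact: kop_cvg mf_ f_c f_f.
    rewrite -(cvg_lim _ L)// -(cvg_lim _ L')//; congr (limn _).
    by apply/funext => n; rewrite innerC (Cf_ n).2 innerC.
move=> f bf g bg; have bKf := kop_bm P bf.
suff [] : bounded_measurable g /\
  inner pi f (kop P g) = inner pi (kop P f) g by [].
elim/bounded_measurable_ind: bg => {g}.
- by move=> A mA; split; [exact: bm_indic | exact: kopl].
- move=> a g h [bg Hg] [bh Hh]; split; first exact: bm_lin.
  by rewrite kop_lin// !inner_linr ?Hg ?Hh//; exact: kop_bm.
- move=> g_ g c mg_ Cg_ g_c g_g.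
  have [mg gc] := bounded_pointwise_lim mg_ g_c g_g.
  split; first by split => //; exists c.
  have L : (fun n => inner pi (kop P f) (g_ n)) @ \oo -->
      inner pi (kop P f) g by exact: inner_bounded_cvgr mg_ g_c g_g.
  have L' : (fun n => inner pi f (kop P (g_ n))) @ \oo -->
      inner pi f (kop P g).
    apply: (@inner_bounded_cvgr _ _ _ _ _ _ _ c) => //.
    + by move=> n; apply: (kop_bm P (Cg_ n).1).1.
    + by move=> n; exact: kop_norm_le.
    + exact: kop_cvg mg_ g_c g_g.
  rewrite -(cvg_lim _ L)// -(cvg_lim _ L')//; congr (limn _).
  by apply/funext => n; rewrite (Cg_ n).2.
Qed.

Lemma inner_iter_kop n f g : bounded_measurable f -> bounded_measurable g ->
  inner pi f (iter n (kop P) g) = inner pi (iter n (kop P) f) g.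
Proof.
move=> bf bg; elim: n f bf => // n IH f bf.
rewrite iterS inner_kop//; last exact: iter_kop_bm.
by rewrite IH ?iterSr//; exact: kop_bm.
Qed.

(** For bounded [f] this is the covariance of [f (X i)] and [f (X (i + n))] along the stationary
    chain, expressed by the operator alone. *)
Definition autocov n f := inner pi f (iter n (kop P) f) - (\int[pi]_x f x) ^+ 2.

(** Self-adjointness moves the iterates onto the constant 1, which they fix. *)
Lemma Rintegral_iter_kop n f : bounded_measurable f ->
  \int[pi]_x iter n (kop P) f x = \int[pi]_x f x.
Proof.
move=> bf; rewrite -inner_cst1 inner_iter_kop ?iter_kop_cst ?inner_cst1//.
exact: bm_cst.
Qed.

(* With m = pi f, autocov n f = <f, K^n f - m>, while self-adjointness gives
   autocov (2n) f = |K^n f - m|^2; the claim is then Cauchy-Schwarz. *)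
Lemma autocov_double n f : bounded_measurable f ->
  autocov n f ^+ 2 <= inner pi f f * autocov (n + n) f.
Proof.
move=> bf; pose m := \int[pi]_x f x; pose g := iter n (kop P) f.
have bg : bounded_measurable g by exact: iter_kop_bm.
have bg1 : bounded_measurable (fun x => (- m) * 1 + g x).
  exact: (bm_lin (- m) (bm_cst _ 1) bg).
have b1 := bm_cst T (1 : R).
have f1 : inner pi f (fun=> 1) = m by rewrite innerC inner_cst1.
have g1 : inner pi (fun=> 1) g = m by rewrite inner_cst1 Rintegral_iter_kop.
have -> : autocov n f = inner pi f (fun x => (- m) * 1 + g x).
  by rewrite inner_linr// f1 /autocov -/m -/g; ring.
suff -> : autocov (n + n) f =
    inner pi (fun x => (- m) * 1 + g x) (fun x => (- m) * 1 + g x).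
  exact: inner_CS.
rewrite inner_linr// !inner_linl// (innerC _ g (fun=> 1)) g1.
rewrite (_ : inner pi (fun=> 1) (fun=> 1) = 1); last first.
  by rewrite inner_cst1 Rintegral_prob_cst//; exact: probability_setT.
by rewrite /autocov iterD inner_iter_kop -/g -/m//; ring.
Qed.

(* A geometric bound with an arbitrary constant C self-improves to the constant
   <f, f>: iterating autocov_double along n, 2n, 4n, ... shows that the 2^j-th
   powers of u 0 stay below C / <f, f>, which forces u 0 <= 1. *)
Lemma autocov_geometric f (C rho : R) : bounded_measurable f -> 0 < rho ->
  (forall n, (0 < n)%N -> `|autocov n f| <= C * rho ^+ n) ->
  forall n, (0 < n)%N -> `|autocov n f| <= rho ^+ n * inner pi f f.
Proof.
move=> bf rho0 HC n n0.
(* The ratios below divide by [<f, f>]; when it vanishes, [autocov_double] already forces the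
   autocovariance to be 0. *)
have [z|ff0] := eqVneq (inner pi f f) 0.
  have := autocov_double n bf; rewrite z mul0r mulr0.
  by rewrite exprn_even_le0//= => /eqP ->; rewrite normr0.
have {}ff0 : 0 < inner pi f f by rewrite lt_def ff0 inner_ge0.
pose u j := `|autocov (2 ^ j * n) f| / (rho ^+ (2 ^ j * n) * inner pi f f).
have den0 j : 0 < rho ^+ (2 ^ j * n) * inner pi f f.
  by rewrite mulr_gt0// exprn_gt0.
have uS j : u j ^+ 2 <= u j.+1.
  rewrite /u expr_div_n ler_pdivrMr ?exprn_gt0//.
  rewrite expnS mul2n -addnn mulnDl exprD real_normK ?num_real//.
  rewrite (le_trans (autocov_double _ bf))//.
  rewrite (le_trans (ler_norm _))// normrM (ger0_norm (ltW ff0)).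
  set r := rho ^+ _; set I := inner _ _ _; set a := `| _ |.
  rewrite [leRHS](_ : _ = I * a)//; field.
  by rewrite !gt_eqF// exprn_gt0.
have uX j : u 0%N ^+ (2 ^ j) <= u j.
  elim: j => [|j IH]; first by rewrite expr1.
  rewrite expnS mulnC exprM (le_trans _ (uS j))// lerXn2r// nnegrE.
    by rewrite exprn_ge0// divr_ge0// ltW.
  by rewrite divr_ge0// ltW.
have uC j : u j <= C / inner pi f f.
  rewrite /u ler_pdivrMr// mulrCA !mulrA mulfVK ?gt_eqF//.
  by rewrite mulrC HC// muln_gt0 expn_gt0.
suff : u 0%N <= 1 by rewrite /u mul1n ler_pdivrMr ?mul1r// mulr_gt0// exprn_gt0.
rewrite leNgt; apply/negP => u1.
(* Bernoulli's inequality makes the powers of [u 0] grow at least linearly if [u 0 > 1], which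
   contradicts the uniform bound [uC]. *)
have bernoulli k : 1 + k%:R * (u 0%N - 1) <= u 0%N ^+ k.
  elim: k => [|k IH]; first by rewrite mul0r addr0.
  rewrite exprS; have : 0 <= (u 0%N ^+ k - (1 + k%:R * (u 0%N - 1))) * u 0%N.
    by rewrite mulr_ge0 ?subr_ge0//; lra.
  have : 0 <= k%:R * (u 0%N - 1) ^+ 2 by rewrite mulr_ge0// sqr_ge0.
  rewrite -natr1; nra.
pose k := Num.bound `|C / inner pi f f / (u 0%N - 1)|.
have := le_trans (bernoulli (2 ^ k)%N) (le_trans (uX k) (uC k)).
apply/negP; rewrite -ltNge ltr_wpDl//.
rewrite -ltr_pdivrMr ?subr_gt0// (le_lt_trans (ler_norm _))//.
rewrite (lt_le_trans (archi_boundP (normr_ge0 _)))// ler_nat ltnW//.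
exact: ltn_expl.
Qed.

End reversible_kernel.

(** * Geometric ergodicity *)

Section measurable_hull.
Context d (T : measurableType d) (R : realType).
Variable pi : probability T R.

(** Intersecting measurable supersets of [E] whose measures tend to the infimum gives a superset [H]
    attaining it. For another measurable superset [B], the set [H] meet [B] is again a competitor,
    so removing [H] minus [B] cannot lower the measure. *)
Lemma measurable_hull (E : set T) : exists H : set T,
  [/\ measurable H, E `<=` H &
      forall B, measurable B -> E `<=` B -> pi (H `\` B) = 0%E].
Proof.
pose S := [set fine (pi B) | B in [set B | measurable B /\ E `<=` B]].
have Sinf : has_inf S.
  split; first by exists (fine (pi setT)); exists setT.
  by exists 0 => _ [B _ <-]; rewrite fine_ge0.
have B_ k : exists B, [/\ measurable B, E `<=` B &
    fine (pi B) < inf S + k.+1%:R^-1].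
  have [|_ [B [mB EB] <-] Bk] := @inf_adherent _ S k.+1%:R^-1 _ Sinf.
    by rewrite invr_gt0.
  by exists B.
have [B BP] := choice B_.
have mH : measurable (\bigcap_k B k).
  by apply: bigcap_measurable => // k _; have [] := BP k.
have EH : E `<=` \bigcap_k B k.
  by move=> x Ex k _; have [_ EB _] := BP k; exact: EB.
have Hinf : fine (pi (\bigcap_k B k)) <= inf S.
  apply/ler_addgt0Pr => e e0.
  have [k ke] : exists k, k.+1%:R^-1 < e.
    exists (Num.bound e^-1); rewrite invf_plt ?posrE//.
    by rewrite (lt_trans (archi_boundP _)) ?ltr_nat// invr_ge0 ltW.
  have [mBk _ Bk] := BP k.
  rewrite (le_trans _ (le_trans (ltW Bk) _))// ?lerD2l ?(ltW ke)//.
  rewrite fine_le ?fin_num_measure// le_measure ?mem_setE//; [exact: mem_set..|].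
  by move=> x; exact.
exists (\bigcap_k B k); split => // D mD ED.
have mHD : measurable (\bigcap_k B k `&` D) by exact: measurableI.
have infHD : inf S <= fine (pi (\bigcap_k B k `&` D)).
  apply: ge_inf; first exact: Sinf.2.
  exists (\bigcap_k B k `&` D) => //; split => // x Ex.
  by split; [exact: EH | exact: ED].
apply/eqP; rewrite eq_le measure_ge0 andbT measureD//; last first.
  by rewrite ltey_eq fin_num_measure.
rewrite -(fineK (fin_num_measure pi _ mH)) -(fineK (fin_num_measure pi _ mHD)).
by rewrite -EFinB lee_fin subr_le0 (le_trans Hinf).
Qed.

(* The null set where no E n is reached is added to every F m, so that the last
   clause holds everywhere and not just almost everywhere. *)
Lemma measurable_hull_exhaustion (E : nat -> set T) :
  (forall m n, (m <= n)%N -> E m `<=` E n) ->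
  measurable (\bigcup_n E n) -> pi (\bigcup_n E n) = 1%E ->
  exists F : nat -> set T,
    [/\ forall m, measurable (F m),
        forall m B, measurable B -> E m `<=` B -> pi (F m `\` B) = 0%E &
        forall x, exists N, forall m, (N <= m)%N -> F m x].
Proof.
move=> ndE mE E1; have [H HP] := choice (fun m => measurable_hull (E m)).
(* Hulls of increasing sets need not increase; intersecting the later ones restores monotonicity.
   [G m] still contains [E m], since [E m] lies in every later [E k]. *)
pose G m := \bigcap_(k in [set k | (m <= k)%N]) H k.
have mG m : measurable (G m).
  by apply: bigcap_measurableType => k _; have [] := HP k.
pose N := ~` \bigcup_m G m.
have mN : measurable N by apply/measurableC/bigcup_measurable => m _; exact: mG.
have N0 : pi N = 0%E.
  apply: (@subset_measure0 _ _ _ pi _ (~` \bigcup_n E n)) => //.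
  - exact: measurableC.
  - apply: subsetC => x [m _ Emx]; exists m => // k /= mk.
    by have [_ EH _] := HP k; apply: EH; exact: ndE mk _ Emx.
  - by have := probability_setC pi mE; rewrite E1 subee.
exists (fun m => G m `|` N); split.
- by move=> m; exact: measurableU.
- move=> m B mB EB; have [mH _ /(_ _ mB EB) HB] := HP m.
  apply: (@subset_measure0 _ _ _ pi _ ((H m `\` B) `|` N)) => //.
  + by apply: measurableD => //; exact: measurableU.
  + by apply: measurableU => //; exact: measurableD.
  + by move=> x [[Gx|Nx] Bx]; [left; split => //; exact: Gx (leqnn m) | right].
  + by apply: null_set_setU => //; exact: measurableD.
- move=> x; have [[m _ Gx]|nx] := pselect ((\bigcup_m G m) x); last first.
    by exists 0%N => m _; right.
  by exists m => k mk; left => j /= kj; apply: Gx; exact: leq_trans kj.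
Qed.

End measurable_hull.

Section geometric.
Context d (T : measurableType d) (R : realType).
Variables (P : R.-pker T ~> T) (pi : probability T R).
Hypothesis P_geo : geometrically_ergodic P pi.

(* F m is a measurable hull of {M <= m}, a set which need not be measurable. *)
Lemma geometrically_ergodic_hull : exists (rho : R) (F : nat -> set T),
  [/\ 0 < rho < 1, forall m, measurable (F m),
      forall x, exists N, forall m, (N <= m)%N -> F m x &
      forall m n A, (0 < n)%N -> measurable A ->
        pi (F m `\` [set x | `|iter n (kop P) \1_A x - fine (pi A)|
                             <= m%:R * rho ^+ n]) = 0%E].
Proof.
have [rho [M [rho1 M0 mM M1 HM]]] := P_geo.
(* The given rate may be zero or negative; the maximum with 1/2 makes it positive and keeps it below
   1. *)
pose r := Num.max rho 2^-1.
have r01 : 0 < r < 1.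
  by rewrite lt_max gt_max rho1 invr_gt0 ltr0n orbT/= invf_lt1// ltr1n.
have [r0 r1] := andP r01.
pose E m := [set x | (M x <= m%:R%:E)%E].
have HE m n A x : (0 < n)%N -> measurable A -> E m x ->
    `|iter n (kop P) \1_A x - fine (pi A)| <= m%:R * r ^+ n.
  (* The bound at time 1 shows that [rho] is nonnegative as soon as [M x > 0], so its powers are at
     most those of [r]. *)
  move=> n0 mA Emx; have := HM n x A n0 mA; have := HM 1%N x A isT mA.
  rewrite !kernel_powE// -(fineK (fin_num_measure pi _ mA)).
  rewrite -!EFinB !abse_EFin.
  have := M0 x; have : (M x <= m%:R%:E)%E by [].
  case: (M x) => // Mx; rewrite -!EFinM !lee_fin expr1 => Mm Mx0 H1 Hn.
  rewrite (le_trans Hn)// (le_trans (_ : _ <= Mx * r ^+ n))//; last first.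
    by rewrite ler_wpM2r// exprn_ge0// ltW.
  have [->|MxN0] := eqVneq Mx 0; first by rewrite !mul0r.
  have {}Mx0 : 0 < Mx by rewrite lt_def MxN0.
  rewrite ler_pM2l// lerXn2r ?nnegrE ?(ltW r0)// ?le_max ?lexx//.
  by move: (le_trans (normr_ge0 _) H1); rewrite pmulr_rge0.
have EM : \bigcup_n E n = [set x | (M x < +oo)%E].
  apply/seteqP; split => x /=.
    by move=> [m _ /le_lt_trans]; apply; rewrite ltry.
  move=> Mx; have Mf : M x \is a fin_num by rewrite ge0_fin_numE.
  exists (Num.bound (fine (M x))) => //=; rewrite /E/= -(fineK Mf) lee_fin.
  by rewrite ltW// archi_boundP// fine_ge0.
have [F [mF FE Fx]] : exists F : nat -> set T,
    [/\ forall m, measurable (F m),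
        forall m B, measurable B -> E m `<=` B -> pi (F m `\` B) = 0%E &
        forall x, exists N, forall m, (N <= m)%N -> F m x].
  apply: measurable_hull_exhaustion; rewrite ?EM//.
  by move=> m n mn x; rewrite /E/= => /le_trans; apply; rewrite lee_fin ler_nat.
exists r, F; split => // m n A n0 mA; apply: FE; last first.
  by move=> x; exact: HE.
have [mK _] := iter_kop_bm P n (bm_indic R mA).
rewrite -[X in measurable X]setTI; apply: measurable_fun_le => //.
by apply: measurableT_comp => //; exact: measurable_funB.
Qed.

(** The approximants are simple functions cut off to the sets [F k]. Their constants [C] may blow up
    with [k], which [autocov_geometric] makes harmless. *)
Lemma mixing_approximation : exists2 rho : R, 0 < rho < 1 &
  forall h : T -> R, measurable_fun setT h ->
  exists f : nat -> T -> R,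
    [/\ forall k, bounded_measurable (f k),
        forall k x, `|f k x| <= `|h x|, forall x, f ^~ x @ \oo --> h x &
        forall k, exists C, forall n, (0 < n)%N ->
          `|autocov P pi n (f k)| <= C * rho ^+ n].
Proof.
have [rho [F [rho01 mF Fx FP]]] := geometrically_ergodic_hull.
have [rho0 rho1] := andP rho01.
exists rho => // h mh.
(* Geometric decay of the covariance of [f] at time 0 and [g] at time [n], with a constant allowed
   to depend on both functions. *)
pose mix f g := exists C, forall n, (0 < n)%N ->
  `|inner pi f (iter n (kop P) g) - (\int[pi]_x f x) * (\int[pi]_x g x)|
    <= C * rho ^+ n.
have bmi f : bounded_measurable f -> pi.-integrable setT (EFin \o f).
  by move=> bf; apply: bm_integrable => //; exact: probability_setT.
have mix_lin_l a f1 f2 g : bounded_measurable f1 -> bounded_measurable f2 ->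
    bounded_measurable g ->
    mix f1 g -> mix f2 g -> mix (fun x => a * f1 x + f2 x) g.
  move=> b1 b2 bg [C1 H1] [C2 H2]; exists (`|a| * C1 + C2) => n n0.
  have bKg := iter_kop_bm P n bg.
  rewrite inner_linl// Rintegral_lin; [|exact: bmi..].
  set I1 := inner _ f1 _; set I2 := inner _ f2 _.
  rewrite (_ : _ - _ = a * (I1 - (\int[pi]_x f1 x) * (\int[pi]_x g x)) +
    (I2 - (\int[pi]_x f2 x) * (\int[pi]_x g x))); last by ring.
  rewrite (le_trans (ler_normD _ _))// mulrDl lerD ?H2//.
  by rewrite normrM -mulrA ler_wpM2l ?H1.
have mix_lin_r a f1 f2 g : bounded_measurable f1 -> bounded_measurable f2 ->
    bounded_measurable g ->
    mix g f1 -> mix g f2 -> mix g (fun x => a * f1 x + f2 x).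
  move=> b1 b2 bg [C1 H1] [C2 H2]; exists (`|a| * C1 + C2) => n n0.
  have bK1 := iter_kop_bm P n b1; have bK2 := iter_kop_bm P n b2.
  rewrite iter_kop_lin// inner_linr// Rintegral_lin; [|exact: bmi..].
  set I1 := inner _ _ _; set I2 := inner _ _ (iter n _ f2).
  rewrite (_ : _ - _ = a * (I1 - (\int[pi]_x g x) * (\int[pi]_x f1 x)) +
    (I2 - (\int[pi]_x g x) * (\int[pi]_x f2 x))); last by ring.
  rewrite (le_trans (ler_normD _ _))// mulrDl lerD ?H2//.
  by rewrite normrM -mulrA ler_wpM2l ?H1.
have mix_indic m A B : measurable A -> measurable B -> A `<=` F m ->
    mix \1_A \1_B.
  move=> mA mB AF; exists m%:R => n n0.
  have bA := bm_indic R mA; have bB := bm_indic R mB.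
  have bK := iter_kop_bm P n bB; have b1 := bm_cst T (1 : R).
  pose p := fine (pi B); pose phi x := (- p) * 1 + iter n (kop P) \1_B x.
  have bphi : bounded_measurable phi by exact: bm_lin.
  rewrite (_ : _ - _ = inner pi \1_A phi); last first.
    rewrite inner_linr// (innerC _ _ (fun=> 1)) inner_cst1.
    by rewrite (Rintegral_indic _ mB) /p; ring.
  pose G := [set x | `|iter n (kop P) \1_B x - p| <= m%:R * rho ^+ n].
  have mG : measurable G.
    rewrite -[X in measurable X]setTI; apply: measurable_fun_le => //.
    by apply: measurableT_comp => //; apply: measurable_funB => //; case: bK.
  have FG0 : pi (F m `\` G) = 0%E by exact: FP.
  have mFG : measurable (F m `\` G) by exact: measurableD.
  have [mphi [c phic]] := bphi.
  rewrite /inner (le_trans (le_normr_Rintegral _ (bmi _ (bm_mul bA bphi))))//.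
  (* Inside [G] the function [phi] is at most [m rho^n]; on the null set [F m] minus [G] only the
     crude bound [c] is available, and it contributes nothing to the integral. *)
  pose up x := c * \1_(F m `\` G) x + m%:R * rho ^+ n.
  have bup : bounded_measurable up.
    by apply: bm_lin; [exact: bm_indic | exact: bm_cst].
  have -> : m%:R * rho ^+ n = \int[pi]_x up x.
    rewrite /up Rintegral_lin; last 2 first.
    - exact/bmi/bm_indic.
    - exact/bmi/bm_cst.
    rewrite Rintegral_indic// [X in fine X]FG0 mulr0 add0r Rintegral_prob_cst//.
    exact: probability_setT.
  apply: le_Rintegral => //.
  - have [mAphi [e Ae]] := bm_mul bA bphi.
    apply: bmi; split; first exact: measurableT_comp.
    by exists e => x; rewrite normr_id.
  - exact: bmi.
  - move=> x _; rewrite /up !indicE normrM.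
    have c0 : 0 <= c := le_trans (normr_ge0 _) (phic x).
    have mr0 : 0 <= m%:R * rho ^+ n by rewrite mulr_ge0// exprn_ge0// ltW.
    have [xA|xA] := boolP (x \in A); last first.
      by rewrite normr0 mul0r addr_ge0// mulr_ge0.
    rewrite normr1 mul1r; have [xG|xG] := pselect (G x).
      rewrite memNset; last by move=> [].
      by rewrite mulr0 add0r /phi mulr1 addrC.
    rewrite mem_set; last by split => //; apply: AF; exact: set_mem xA.
    by rewrite mulr1 (le_trans (phic x))// lerDl.
have bF m : bounded_measurable (\1_(F m) : T -> R) by exact: bm_indic.
have mulF m (a : R) (f g : T -> R) : (fun x => (a * f x + g x) * \1_(F m) x) =
    (fun x => a * (f x * \1_(F m) x) + g x * \1_(F m) x).
  by apply/funext => x; ring.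
have indF m A : (fun x => \1_A x * \1_(F m) x) = \1_(A `&` F m) :> (T -> R).
  by rewrite indicI.
(* Bilinear extension from indicators in two stages: [L] handles the left argument against
   indicators, [S] the right argument against cut-off members of [L]. Indicators stay indicators
   after the cut-off, so both classes contain them. *)
pose L f := bounded_measurable f /\
  forall m B, measurable B -> mix (fun x => f x * \1_(F m) x) \1_B.
pose S f := L f /\ forall m g, L g ->
  mix (fun x => g x * \1_(F m) x) (fun x => f x * \1_(F m) x).
have Lindic A : measurable A -> L \1_A.
  move=> mA; split=> [|m B mB]; first exact: bm_indic.
  by rewrite indF; apply: (mix_indic m) => //; exact: measurableI.
have Llin a f g : L f -> L g -> L (fun x => a * f x + g x).
  move=> [bf Lf] [bg Lg]; split=> [|m B mB]; first exact: bm_lin.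
  by rewrite mulF; apply: mix_lin_l;
    [exact: bm_mul | exact: bm_mul | exact: bm_indic | exact: Lf | exact: Lg].
have Sindic A : measurable A -> S \1_A.
  move=> mA; split=> [|m g [_ Lg]]; first exact: Lindic.
  by rewrite [X in mix _ X]indF; apply: Lg; exact: measurableI.
have Slin a f g : S f -> S g -> S (fun x => a * f x + g x).
  move=> [Lf Sf] [Lg Sg]; split=> [|m u Lu]; first exact: Llin.
  rewrite [X in mix _ X]mulF; apply: mix_lin_r; [| | |exact: Sf|exact: Sg].
  - by apply: bm_mul => //; case: Lf.
  - by apply: bm_mul => //; case: Lg.
  - by apply: bm_mul => //; case: Lu.
have [s [Ss _ sh s_h]] := simple_approx Sindic Slin mh.
exists (fun k x => s k x * \1_(F k) x); split.
- by move=> k; apply: bm_mul => //; have [[]] := Ss k.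
- move=> k x; rewrite indicE; case: (x \in F k); first by rewrite mulr1.
  by rewrite mulr0 normr0.
(* Each point lies in all but finitely many [F k], so the cut-off is eventually invisible there. *)
- move=> x; have [N FN] := Fx x; apply: cvg_trans (s_h x).
  apply: near_eq_cvg; exists N => //= k Nk.
  by rewrite indicE mem_set ?mulr1//; exact: FN.
- move=> k; have [Lk Sk] := Ss k; have [C HC] := Sk k _ Lk; exists C => n n0.
  by rewrite /autocov expr2 HC.
Qed.

End geometric.

(** * Stationary chains *)

Section markov_chain.
Context d (T : measurableType d) (R : realType).
Variables (P : R.-pker T ~> T) (pi : probability T R).
Hypothesis pi_stat : stationary P pi.
Context d' (Omega : measurableType d').
Variables (Pr : probability Omega R) (X : nat -> {RV Pr >-> T}).
Hypothesis X_chain : stationary_markov_chain P pi X.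
Implicit Types f g : T -> R.

Lemma measurable_RV n : measurable_fun setT (X n).
Proof. exact: measurable_funPT. Qed.

Lemma chain_law n A : measurable A -> Pr (X n @^-1` A) = pi A.
Proof.
have [X0 XS] := X_chain; elim: n A => [|n IH] A mA; first exact: X0.
(* With trivial past events the Markov property gives the law of [X n.+1] from that of [X n];
   stationarity closes the induction. *)
have := XS n (fun=> setT) A (fun=> measurableT) mA => /=.
set past := \bigcap_(_ in _) _; have -> : past = setT by apply/seteqP; split.
rewrite setTI => ->.
transitivity (\int[distribution Pr (X n)]_x P x A)%E.
  by rewrite ge0_integral_distribution//; exact: measurable_kernel.
by rewrite -(pi_stat mA); apply: eq_measure_integral => B mB _; exact: IH.
Qed.

Lemma chain_integral n (f : T -> \bar R) : measurable_fun setT f ->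
  (forall x, 0 <= f x)%E -> (\int[Pr]_w f (X n w) = \int[pi]_x f x)%E.
Proof.
move=> mf f0; transitivity (\int[distribution Pr (X n)]_x f x)%E.
  by rewrite ge0_integral_distribution.
by apply: eq_measure_integral => B mB _; exact: chain_law.
Qed.

Lemma chain_integrable n (f : T -> \bar R) : pi.-integrable setT f ->
  Pr.-integrable setT (f \o X n).
Proof.
move=> /integrableP[mf fi]; apply/integrableP; split.
  exact: measurableT_comp (measurable_RV n).
rewrite (chain_integral n (f := fun x => `|f x|%E))//.
exact: measurableT_comp.
Qed.

Lemma chain_Rintegral n f : pi.-integrable setT (EFin \o f) ->
  \int[Pr]_w f (X n w) = \int[pi]_x f x.
Proof.
move=> fi; rewrite /Rintegral; congr fine.
rewrite -(integral_distribution (X := X n) (f := EFin \o f)).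
- by apply: eq_measure_integral => B mB _; exact: chain_law.
- exact: measurable_int fi.
- exact: chain_integrable.
Qed.

Lemma chain_bm n f : bounded_measurable f -> bounded_measurable (f \o X n).
Proof.
move=> [mf [c fc]]; split; first exact: measurableT_comp (measurable_RV n).
by exists c => w; exact: fc.
Qed.

(** The Markov property tested against a single earlier time, which suffices for covariances. *)
Lemma inner_chain_step i n A g : (i <= n)%N -> measurable A ->
  bounded_measurable g ->
  inner Pr (\1_A \o X i) (g \o X n.+1) = inner Pr (\1_A \o X i) (kop P g \o X n).
Proof.
move=> ni mA bg; have bA := chain_bm i (bm_indic R mA).
suff [] : bounded_measurable g /\ inner Pr (\1_A \o X i) (g \o X n.+1) =
  inner Pr (\1_A \o X i) (kop P g \o X n) by [].
elim/bounded_measurable_ind: bg => {g}.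
- move=> B mB; split; first exact: bm_indic.
  have -> : (\1_A \o X i : Omega -> R) = \1_(X i @^-1` A) by [].
  rewrite !inner_indicl kop_indic//.
  (* Constraining only time [i] reduces the past event to [X i] in [A]. *)
  have [_ /(_ n (fun j => if j == i then A else setT) B)] := X_chain.
  have -> : \bigcap_(j in `I_n.+1) X j @^-1` (if j == i then A else setT) =
      X i @^-1` A.
    apply/seteqP; split => [w /(_ i ni)|w Aw j _] /=; first by rewrite eqxx.
    by case: eqP => // ->.
  move=> /(_ _ mB) XS; rewrite /Rintegral; congr fine.
  transitivity (Pr (X i @^-1` A `&` X n.+1 @^-1` B)); last first.
    rewrite XS; last by move=> j; case: ifP.
    by apply: eq_integral => w _; rewrite fineK//; exact: finite_kernel_measure.
  have -> : (fun w => ((\1_B \o X n.+1) w)%:E) =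
      (fun w => (\1_(X n.+1 @^-1` B) w)%:E : \bar R) by [].
  rewrite integral_indic; first by rewrite setIC.
  - by rewrite -[X in measurable X]setTI; exact: measurable_RV.
  - by rewrite -[X in measurable X]setTI; exact: measurable_RV.
- move=> a f g [bf Hf] [bg Hg]; split; first exact: bm_lin.
  rewrite kop_lin//.
  rewrite (_ : _ \o X n.+1 = fun w => a * (f \o X n.+1) w + (g \o X n.+1) w)//.
  rewrite (_ : (fun _ => _) \o X n =
    fun w => a * (kop P f \o X n) w + (kop P g \o X n) w)//.
  rewrite !inner_linr ?Hf ?Hg//; try exact: chain_bm.
  + exact/chain_bm/kop_bm.
  + exact/chain_bm/kop_bm.
- move=> f_ f c mf_ Cf_ f_c f_f.
  have [mf fc] := bounded_pointwise_lim mf_ f_c f_f.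
  split; first by split => //; exists c.
  have L : (fun k => inner Pr (\1_A \o X i) (f_ k \o X n.+1)) @ \oo -->
      inner Pr (\1_A \o X i) (f \o X n.+1).
    apply: (@inner_bounded_cvgr _ _ _ _ _ _ _ c) => //.
    + by move=> k; exact: (chain_bm n.+1 (Cf_ k).1).1.
    + by move=> k w; exact: f_c.
    + by move=> w; exact: f_f.
  have L' : (fun k => inner Pr (\1_A \o X i) (kop P (f_ k) \o X n)) @ \oo -->
      inner Pr (\1_A \o X i) (kop P f \o X n).
    apply: (@inner_bounded_cvgr _ _ _ _ _ _ _ c) => //.
    + by move=> k; exact: (chain_bm n (kop_bm P (Cf_ k).1)).1.
    + by move=> k w; exact: kop_norm_le.
    + by move=> w; exact: kop_cvg mf_ f_c f_f _.
  rewrite -(cvg_lim _ L)// -(cvg_lim _ L')//; congr (limn _).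
  by apply/funext => k; rewrite (Cf_ k).2.
Qed.

(** For an indicator [f], each Markov step replaces [g] by [kop P g] one time earlier, until both
    factors sit at time [i], whose law is [pi]. Induction on [f] then covers bounded functions. *)
Lemma inner_chain i k f g : bounded_measurable f -> bounded_measurable g ->
  inner Pr (f \o X i) (g \o X (i + k)%N) = inner pi f (iter k (kop P) g).
Proof.
move=> bf bg.
have indic A : measurable A ->
    inner Pr (\1_A \o X i) (g \o X (i + k)%N) = inner pi \1_A (iter k (kop P) g).
  move=> mA; have bA := bm_indic R mA.
  elim: k g bg => [|k IH] g bg.
    rewrite addn0 /= /inner -(chain_Rintegral i)//.
    by apply: bm_integrable; [exact: probability_setT | exact: bm_mul].
  rewrite addnS inner_chain_step ?leq_addr// IH ?iterSr//.
  exact: kop_bm.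
have bK := iter_kop_bm P k bg; have bgX := chain_bm (i + k) bg.
suff [] : bounded_measurable f /\
  inner Pr (f \o X i) (g \o X (i + k)%N) = inner pi f (iter k (kop P) g) by [].
elim/bounded_measurable_ind: bf => {f}.
- by move=> A mA; split; [exact: bm_indic | exact: indic].
- move=> a f1 f2 [b1 H1] [b2 H2]; split; first exact: bm_lin.
  rewrite (_ : _ \o X i = fun w => a * (f1 \o X i) w + (f2 \o X i) w)//.
  by rewrite !inner_linl ?H1 ?H2//; exact: chain_bm.
- move=> f_ f c mf_ Cf_ f_c f_f.
  have [mf fc] := bounded_pointwise_lim mf_ f_c f_f.
  split; first by split => //; exists c.
  rewrite (innerC _ (f \o X i)) (innerC _ f).
  have L : (fun k' => inner Pr (g \o X (i + k)%N) (f_ k' \o X i)) @ \oo -->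
      inner Pr (g \o X (i + k)%N) (f \o X i).
    apply: (@inner_bounded_cvgr _ _ _ _ _ _ _ c) => //.
    + by move=> k'; exact: (chain_bm i (Cf_ k').1).1.
    + by move=> k' w; exact: f_c.
    + by move=> w; exact: f_f.
  have L' : (fun k' => inner pi (iter k (kop P) g) (f_ k')) @ \oo -->
      inner pi (iter k (kop P) g) f by exact: inner_bounded_cvgr mf_ f_c f_f.
  rewrite -(cvg_lim _ L)// -(cvg_lim _ L')//; congr (limn _).
  by apply/funext => k'; rewrite innerC (Cf_ k').2 innerC.
Qed.

End markov_chain.

(** * Autocovariances of square-integrable functions along the chain *)

Section autocovariance.
Context d (T : measurableType d) (R : realType).
Variables (P : R.-pker T ~> T) (pi : probability T R).
Hypotheses (P_rev : reversible P pi) (pi_stat : stationary P pi).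
Context d' (Omega : measurableType d').
Variables (Pr : probability Omega R) (X : nat -> {RV Pr >-> T}).
Hypothesis X_chain : stationary_markov_chain P pi X.
Variables (h : T -> R) (h_L2 : square_integrable pi h).

Lemma chain_square_integrable n : square_integrable Pr (h \o X n).
Proof.
have [mh hi] := h_L2; split; first exact: measurableT_comp (measurable_RV X n).
exact: (chain_integrable pi_stat X_chain n hi).
Qed.

Section approximation.
Variable f : nat -> T -> R.
Hypotheses (bf : forall m, bounded_measurable (f m))
  (fh : forall m x, `|f m x| <= `|h x|) (f_h : forall x, f ^~ x @ \oo --> h x).

(** Carries [inner_chain], available for bounded functions only, over to [h] in L2 by dominated
    convergence on [Omega]. *)
Lemma inner_chain_cvg i k : (fun m => inner pi (f m) (iter k (kop P) (f m))) @ \oo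
  --> inner Pr (h \o X i) (h \o X (i + k)%N).
Proof.
under eq_fun do rewrite -(inner_chain pi_stat X_chain i k) //.
have [_ hi] := chain_square_integrable i.
have [_ hk] := chain_square_integrable (i + k).
(* The majorant of the products, integrable because both [X i] and [X (i + k)] have law [pi]. *)
pose g w := h (X i w) ^+ 2 + h (X (i + k)%N w) ^+ 2.
apply: (Rintegral_dominated_cvg (g := g)).
- move=> m; have [mi _] := chain_bm X i (bf m).
  by have [mk _] := chain_bm X (i + k) (bf m); exact: measurable_funM.
- by move=> w; apply: cvgM; exact: f_h.
- by apply: eq_integrable (integrableD measurableT hi hk).
- move=> m w; rewrite /g /= normrM -[h (X i w) ^+ 2]real_normK ?num_real//.
  rewrite -[h (X (i + k)%N w) ^+ 2]real_normK ?num_real//.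
  have := fh m (X i w); have := fh m (X (i + k)%N w).
  have := normr_ge0 (f m (X i w)); have := normr_ge0 (f m (X (i + k)%N w)).
  set a := `|f _ _|; set b := `|f _ _|; set a' := `|h _|; set b' := `|h _|.
  move=> a0 b0 aa bb; rewrite (@le_trans _ _ (b' * a'))//.
    by rewrite ler_pM.
  have := sqr_ge0 (a' - b'); have := sqr_ge0 a'; have := sqr_ge0 b'.
  by rewrite !expr2; nra.
Qed.

Lemma inner_approximation_cvg :
  (fun m => inner pi (f m) (f m)) @ \oo --> inner pi h h.
Proof.
have [mh hi] := h_L2.
apply: (Rintegral_dominated_cvg _ _ hi).
- by move=> m; have [mf _] := bf m; exact: measurable_funM.
- by move=> x; apply: cvgM; exact: f_h.
- move=> m x; rewrite normrM -[h x ^+ 2]real_normK ?num_real// expr2.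
  by rewrite ler_pM.
Qed.

Lemma Rintegral_approximation_cvg :
  (fun m => \int[pi]_x f m x) @ \oo --> \int[pi]_x h x.
Proof.
have hi := square_integrable_integrable h_L2.
apply: (Rintegral_dominated_cvg (g := fun x => `|h x|)) => //.
- by move=> m; case: (bf m).
- exact: (integrable_abse hi).
Qed.

(** Both sides are limits of one sequence, in which [i] does not occur. *)
Lemma chain_autocov_stationary i k :
  inner Pr (h \o X i) (h \o X (i + k)%N) = inner Pr (h \o X 0%N) (h \o X k).
Proof.
rewrite -(cvg_lim _ (@inner_chain_cvg i k))//.
by rewrite -(cvg_lim _ (@inner_chain_cvg 0 k)).
Qed.

(** [C] depends on [m], so the hypothesis itself does not pass to the limit; after
    [autocov_geometric] the constant is [<f m, f m>], which converges to [<h, h>]. *)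
Lemma chain_autocov_geometric (rho : R) i k : 0 < rho ->
  (forall m, exists C, forall n, (0 < n)%N ->
     `|autocov P pi n (f m)| <= C * rho ^+ n) ->
  (0 < k)%N ->
  `|inner Pr (h \o X i) (h \o X (i + k)%N) - (\int[pi]_x h x) ^+ 2|
    <= rho ^+ k * inner pi h h.
Proof.
move=> rho0 HC k0.
have L : (fun m => `|autocov P pi k (f m)|) @ \oo -->
    `|inner Pr (h \o X i) (h \o X (i + k)%N) - (\int[pi]_x h x) ^+ 2|.
  apply: cvg_norm; apply: cvgB; first exact: inner_chain_cvg.
  by rewrite expr2; apply: cvgM; exact: Rintegral_approximation_cvg.
have L' : (fun m => rho ^+ k * inner pi (f m) (f m)) @ \oo -->
    rho ^+ k * inner pi h h by apply: cvgMl_tmp; exact: inner_approximation_cvg.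
apply: ler_cvg_to L L' _; apply: nearW => m.
by have [C HCm] := HC m; exact: autocov_geometric HCm _ k0.
Qed.

End approximation.

Lemma inner_chain0 : inner Pr (h \o X 0%N) (h \o X 0%N) = inner pi h h.
Proof.
exact: (chain_Rintegral pi_stat X_chain 0 (square_integrableM h_L2 h_L2)).
Qed.

Definition chain_sum n w : R := \sum_(1 <= i < n.+1) h (X i w).

Lemma chain_sumS n : chain_sum n.+1 = fun w => 1 * chain_sum n w + h (X n.+1 w).
Proof. by apply/funext => w; rewrite /chain_sum big_nat_recr//= mul1r. Qed.

Lemma chain_sum0 : chain_sum 0 = fun=> 0.
Proof. by apply/funext => w; rewrite /chain_sum big_geq. Qed.

Lemma chain_sum_square_integrable n : square_integrable Pr (chain_sum n).
Proof.
elim: n => [|n IH].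
  by rewrite chain_sum0; apply: bm_square_integrable; exact: bm_cst.
by rewrite chain_sumS; apply: square_integrable_lin (chain_square_integrable _).
Qed.

Lemma inner_chain_sum n g : square_integrable Pr g ->
  inner Pr (chain_sum n) g = \sum_(1 <= i < n.+1) inner Pr (h \o X i) g.
Proof.
move=> sg; elim: n => [|n IH].
  rewrite chain_sum0 big_geq//.
  rewrite /inner; under eq_Rintegral do rewrite mul0r.
  by rewrite Rintegral_prob_cst//; exact: probability_setT.
rewrite chain_sumS big_nat_recr//= -IH L2_inner_linl ?mul1r//.
- exact: chain_sum_square_integrable.
- exact: chain_square_integrable.
Qed.

(** Passing from [n] to [n + 1] adds the new square and twice the covariances at lags 1 to [n].
    Writing the second moment as a sum of these increments prepares for Cesaro. *)
Lemma inner_chain_sum_sum n :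
  (forall i k, inner Pr (h \o X i) (h \o X (i + k)%N) =
               inner Pr (h \o X 0%N) (h \o X k)) ->
  inner Pr (chain_sum n) (chain_sum n) =
  series (fun m => inner pi h h +
    2 * series (fun k => inner Pr (h \o X 0%N) (h \o X k.+1)) m) n.
Proof.
move=> stat; have sX := chain_square_integrable.
have sS := chain_sum_square_integrable.
elim: n => [|n IH].
  rewrite inner_chain_sum ?big_geq// /series/= ?big_geq//.
rewrite [RHS]/series/= big_nat_recr//= -[X in _ = X + _]/(series _ n) -IH.
have sXn : square_integrable Pr (fun w => h (X n.+1 w)) by exact: sX.
rewrite {1}chain_sumS L2_inner_linl// chain_sumS !L2_inner_linr//.
rewrite (innerC _ _ (chain_sum n)).
have -> : inner Pr (chain_sum n) (fun w => h (X n.+1 w)) =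
    series (fun k => inner Pr (h \o X 0%N) (h \o X k.+1)) n.
  rewrite inner_chain_sum; last exact: sX.
  (* Reversal lists the lags [n + 1 - i] in increasing order. *)
  rewrite big_nat_rev/= /series/= big_add1/=.
  apply: eq_big_nat => i /andP[_ ni].
  rewrite -(stat (n - i)%N) add1n subSS; congr inner.
  apply/funext => w /=; congr (h (X _ w)); lia.
have -> : inner Pr (fun w => h (X n.+1 w)) (fun w => h (X n.+1 w)) = inner pi h h.
  have := stat n.+1 0%N; rewrite addn0 => ->; exact: inner_chain0.
ring.
Qed.

End autocovariance.

(** * Cesaro averaging and the uniform constant *)

Theorem theorem1 (d : measure_display) (T : measurableType d) (R : realType)
    (P : R.-pker T ~> T) (pi : probability T R)
    (pi_unique : unique_stationary P pi)
    (P_rev : reversible P pi)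
    (P_geo : geometrically_ergodic P pi) :
  variance_bounding P pi.
Proof.
have [pi_stat _] := pi_unique.
have [rho /andP[rho0 rho1] mix] := mixing_approximation P_geo.
have rhoN : `|rho| < 1 by rewrite ger0_norm// ltW.
(* This is 1 plus twice the sum of [rho^k] over [k >= 1]. *)
exists (1 + 2 * (rho / (1 - rho))) => h V_fin d' Omega Pr X X_chain.
have mh : measurable_fun setT h by exact: measurable_funPT.
have h_L2 := finite_variance_square_integrable mh V_fin.
(* After centering, covariances are plain inner products and [<h0, h0>] is the variance of [h]. *)
pose c := \int[pi]_x h x; pose h0 x := h x - c.
have h0_L2 : square_integrable pi h0.
  have := square_integrable_lin (- c) (bm_square_integrable pi (bm_cst T 1)) h_L2.
  by congr square_integrable; apply/funext => x; rewrite /h0 mulr1 addrC.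
have h0_mean : \int[pi]_x h0 x = 0.
  rewrite RintegralB//; last 2 first.
  - exact: square_integrable_integrable h_L2.
  - by apply: bm_integrable; [exact: probability_setT | exact: bm_cst].
  by rewrite Rintegral_prob_cst ?subrr//; exact: probability_setT.
have [f [bf fh f_h fmix]] := mix h0 h0_L2.1.
have stat := chain_autocov_stationary pi_stat X_chain h0_L2 bf fh f_h.
pose V := inner pi h0 h0.
have V0 : 0 <= V by exact: inner_ge0.
pose gam k := inner Pr (h0 \o X 0%N) (h0 \o X k).
(* Lag [k + 1] has bound [V rho^(k+1)], hence the first term [V * rho] of the geometric sequence. *)
have gamP k : `|gam k.+1| <= geometric (V * rho) rho k.
  have := chain_autocov_geometric P_rev pi_stat X_chain h0_L2 bf fh f_h 0
    rho0 fmix (ltn0Sn k).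
  by rewrite h0_mean expr0n subr0 /geometric/= exprS mulrC mulrA.
(* The increment of the variance of the partial sums from [m] to [m + 1]. *)
pose w m := V + 2 * series (fun k => gam k.+1) m.
have w_cvg : cvgn w.
  apply: is_cvgD; first exact: is_cvg_cst.
  apply: is_cvgMl_tmp; apply: normed_cvg.
  apply: series_le_cvg gamP _ => //; last exact: is_cvg_geometric_series.
  by move=> n; rewrite geometric_ge0 ?mulr_ge0// ltW.
have w_le m : w m <= (1 + 2 * (rho / (1 - rho))) * V.
  rewrite /w [leRHS]mulrDl mul1r lerD2l -mulrA ler_pM2l//.
  rewrite (_ : _ * V = V * rho / (1 - rho)); last by rewrite mulrAC (mulrC V).
  apply: le_trans (geometric_le_lim m _ rho0 rhoN); last first.
    by rewrite mulr_ge0// ltW.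
  by apply: ler_sum => k _; rewrite (le_trans (ler_norm _)).
have varE n : 'V_Pr[fun w => \sum_(1 <= i < n.+1) h (X i w)] = (series w n)%:E.
  have S_L2 : square_integrable Pr (fun w => \sum_(1 <= i < n.+1) h (X i w)).
    exact: (chain_sum_square_integrable pi_stat X_chain h_L2 n).
  have SE w' : \sum_(1 <= i < n.+1) h (X i w') =
      chain_sum X h0 n w' + n%:R * c.
    rewrite /chain_sum /h0 sumrB sumr_const_nat subSS subn0 mulr_natl.
    by rewrite subrK.
  rewrite L2_varianceE//; congr (_%:E).
  have S0_L2 := chain_sum_square_integrable pi_stat X_chain h0_L2 n.
  have S0i := square_integrable_integrable S0_L2.
  have -> : \int[Pr]_w' (\sum_(1 <= i < n.+1) h (X i w')) = n%:R * c.
    under eq_Rintegral do rewrite SE.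
    rewrite RintegralD//; last first.
      by apply: bm_integrable; [exact: probability_setT | exact: bm_cst].
    rewrite Rintegral_prob_cst; last exact: probability_setT.
    rewrite -inner_cst1 innerC.
    rewrite (inner_chain_sum pi_stat X_chain h0_L2); last first.
      exact/bm_square_integrable/bm_cst.
    rewrite big1 ?add0r// => i _; rewrite innerC inner_cst1.
    rewrite (chain_Rintegral pi_stat X_chain)//.
    exact: square_integrable_integrable h0_L2.
  rewrite -(inner_chain_sum_sum pi_stat X_chain h0_L2 n stat).
  by congr inner; apply/funext => w'; rewrite SE addrK.
have scaledE n : scaled_variance X h n = (n%:R^-1 * series w n)%:E.
  by rewrite /scaled_variance varE.
have s_cvg : cvgn (scaled_variance X h).
  (* The shift skips [n = 0]; from there on the scaled variances are the Cesaro means of [w]. *)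
  apply/cvg_ex; exists (limn w)%:E; rewrite -cvg_shiftS.
  under eq_fun do rewrite scaledE.
  apply: cvg_EFin; first exact: nearW.
  exact: cesaro w_cvg.
split => //; apply: lime_le => //; apply: nearW => n.
have -> : 'V_pi[h] = V%:E by exact: L2_varianceE.
rewrite scaledE -EFinM lee_fin.
(* At [n = 0] the inverse is 0 by convention, and nonnegativity of the bound suffices. *)
have [->|n0] := posnP n.
  rewrite invr0 mul0r mulr_ge0// addr_ge0// mulr_ge0//.
  by rewrite divr_ge0 ?subr_ge0// ltW.
rewrite mulrC ler_pdivrMr ?ltr0n// /series/=.
rewrite (le_trans (ler_sum _ (fun k _ => w_le k)))//.
by rewrite sumr_const_nat subn0 mulr_natr.
Qed.
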